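(* Let $\chi=(\mathcal V_1,\{e_i\},\{\gamma_i\},\{\varepsilon_i\})_{i\in\{0,1,2\}}$ be the positive affine geometric crystal of type $D_4^{(3)}$, with positive structure $\theta:T'=(\mathbb C^\times)^6\to\mathcal V_1$, $x\mapsto V_1(x)$, whose explicit form is given in the context. Let $B_\infty$ be the $G_2^{(1)}$-crystal described in the context (the limit of the coherent family of perfect crystals $\{B_l\}_{l\ge1}$ of type $G_2^{(1)}$). Then the ultra-discretization $\mathcal{UD}(\chi,T',\theta)$ (a crystal with underlying set $\mathbb Z^6$) is isomorphic, as a crystal, to $B_\infty$. That is, there is a bijection $\mathcal{UD}(\chi,T',\theta)\to B_\infty$ commuting with all $\tilde e_i,\tilde f_i$ and preserving $\mathrm{wt}$, $\varepsilon_i$ and $\varphi_i$ for $i=0,1,2$.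
   Context: **Ultra-discretization.** A nonzero rational function $f$ on a torus $(\mathbb C^\times)^k$ is positive if it is a quotient of two linear combinations of Laurent monomials with positive coefficients. For such $f$, $\mathcal{UD}(f):\mathbb Z^k\to\mathbb Z$ is defined by $\mathcal{UD}(f)(m_1,\dots,m_k)=\deg_t f(t^{m_1},\dots,t^{m_k})$, where $\deg_t$ is the degree of the pole at $t=\infty$ (numerator degree minus denominator degree). Equivalently, in any subtraction-free expression replace $xy\mapsto x+y$, $x/y\mapsto x-y$, $x+y\mapsto\max(x,y)$, and positive constants by $0$. For a positive rational map between tori, $\mathcal{UD}$ is applied componentwise. Given rational functions $\gamma_i,\varepsilon_i$ and rational $\mathbb C^\times$-actions $e_i^c$ on $(\mathbb C^\times)^6$, all positive (the actions being positive in $(c,x)$), the crystal $\mathcal{UD}(\chi,T',\theta)$ is the set $\mathbb Z^6$ with the following data: - $\mathrm{wt}_i=\mathcal{UD}(\gamma_i)$ and $\varepsilon_i=\mathcal{UD}(\varepsilon_i)$; - $\tilde e_i(x)=\mathcal{UD}(e_i)(1,x)$ and $\tilde f_i(x)=\mathcal{UD}(e_i)(-1,x)$, where the first argument is the integer value substituted for $c$; - $\varphi_i=\varepsilon_i+\mathrm{wt}_i$. Weights lie in $P_{\rm cl}=\bigoplus_{i=0}^2\mathbb Z\Lambda_i$ with $\mathrm{wt}=\sum_i \mathrm{wt}_i\Lambda_i$, so $\mathrm{wt}_i=\langle\alpha_i^\vee,\mathrm{wt}\rangle$. **The geometric crystal $\chi$ of type $D_4^{(3)}$** (in coordinates $x=(x_0,\dots,x_5)\in(\mathbb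 C^\times)^6$, identified with $V_1(x)$). The Cartan matrix of $D_4^{(3)}$ is $\begin{pmatrix}2&-1&0\\-1&2&-3\\0&-1&2\end{pmatrix}$. Put $$A_1=\frac{x_0}{x_1},\quad A_2=\frac{x_0x_2}{x_1^2x_3},\quad A_3=\frac{x_0x_2x_4}{x_1^2x_3^2x_5},\quad B_1=\frac{x_1^3}{x_2},\quad B_2=\frac{x_1^3x_3^3}{x_2^2x_4}.$$ *Index 1:* $e_1^c(x)=(x_0,\mathcal C_1x_1,x_2,\mathcal C_3x_3,x_4,\mathcal C_5x_5)$ with $$\mathcal C_1=\frac{cA_1+A_2+A_3}{A_1+A_2+A_3},\quad \mathcal C_3=\frac{cA_1+cA_2+A_3}{cA_1+A_2+A_3},\quad \mathcal C_5=\frac{c(A_1+A_2+A_3)}{cA_1+cA_2+A_3},$$ $\varepsilon_1=A_1+A_2+A_3$, $\gamma_1=\dfrac{x_1^2x_3^2x_5^2}{x_0x_2x_4}$. *Index 2:* $e_2^c(x)=(x_0,x_1,\mathcal C_2x_2,x_3,\mathcal C_4x_4,x_5)$ with $$\mathcal C_2=\frac{cB_1+B_2}{B_1+B_2},\quad \mathcal C_4=\frac{c(B_1+B_2)}{cB_1+B_2},$$ $\varepsilon_2=B_1+B_2$, $\gamma_2=\dfrac{x_2^2x_4^2}{x_1^3x_3^3x_5^3}$. *Index 0:* Put $$p_1=x_0^2x_2x_3,\ \ p_2=x_1x_2x_3^2x_5,\ \ p_3=x_0x_1x_3^3,\ \ p_4=x_0x_2x_3^2,\ \ p_5=x_0x_1x_2x_4,\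 \ p_6=x_0x_1x_2x_3x_5,$$ $$D=c^2p_1+p_2+c(p_3+p_4+p_5+p_6),\qquad E=p_1+p_2+p_3+p_4+p_5+p_6,$$ $$F=p_2+p_4+c(p_1+p_3+p_5+p_6),\qquad H=c\,p_1+p_2+p_3+p_4+p_5+c\,p_6,$$ and, with $L=c\,p_1+p_2+p_4+c\,p_6$, $$G=L^3+3L^2(p_3+c\,p_5)+3L(p_3+p_5)(p_3+c^2p_5)+(p_3+p_5)^2(p_3+c^3p_5).$$ Then $$e_0^c(x)=\Big(\frac{D}{cE}x_0,\ \frac{F}{cE}x_1,\ \frac{G}{c^3E^3}x_2,\ \frac{DH}{c^2EF}x_3,\ \frac{D^3}{c^3G}x_4,\ \frac{D}{cH}x_5\Big),$$ $\varepsilon_0=\dfrac{E}{x_0^3x_2x_3}$, $\gamma_0=\dfrac{x_0^2}{x_1x_3x_5}$. **The $G_2^{(1)}$-crystal $B_\infty$.** The Cartan matrix of $G_2^{(1)}$ is $\begin{pmatrix}2&-1&0\\-1&2&-1\\0&-3&2\end{pmatrix}$ (entries $a_{ij}=\langle\alpha_i^\vee,\alpha_j\rangle$), so in $P_{\rm cl}$: $\alpha_0=2\Lambda_0-\Lambda_1$, $\alpha_1=-\Lambda_0+2\Lambda_1-3\Lambda_2$, $\alpha_2=-\Lambda_1+2\Lambda_2$. As a set, $$B_\infty=\{b=(b_1,b_2,b_3,\bar b_3,\bar b_2,\bar b_1)\in(\tfrac13\mathbb Z)^6:\ 3b_3\equiv3\bar b_3\ (\mathrm{mod}\ 2),\ \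 b_1,\ \bar b_1,\ b_2-b_3,\ \bar b_3-\bar b_2\in\mathbb Z\}.$$ Write $(x)_+=\max(x,0)$, $s(b)=b_1+b_2+\frac{b_3+\bar b_3}2+\bar b_2+\bar b_1$, $z_1=\bar b_1-b_1$, $z_2=\bar b_2-\bar b_3$, $z_3=b_3-b_2$, $z_4=(\bar b_3-b_3)/2$. Conditions: - $(F_1)$: $z_1+z_2+z_3+3z_4\le0$, $z_1+z_2+3z_4\le0$, $z_1+z_2\le0$, $z_1\le0$. - $(F_2)$: $z_1+z_2+z_3+3z_4\le0$, $z_2+3z_4\le0$, $z_2\le0$, $z_1>0$. - $(F_3)$: $z_1+z_3+3z_4\le0$, $z_3+3z_4\le0$, $z_4\le0$, $z_2>0$, $z_1+z_2>0$. - $(F_4)$: $z_1+z_2+3z_4>0$, $z_2+3z_4>0$, $z_4>0$, $z_3\le0$, $z_1+z_3\le0$. - $(F_5)$: $z_1+z_2+z_3+3z_4>0$, $z_3+3z_4>0$, $z_3>0$, $z_1\le0$. - $(F_6)$: $z_1+z_2+z_3+3z_4>0$, $z_1+z_3+3z_4>0$, $z_1+z_3>0$, $z_1>0$. Condition $(E_i)$ is obtained from $(F_i)$ by replacing every $>$ by $\ge$ and every $\le$ by $<$. In the following, each operator is described by the change it makes to the listed coordinates; all other coordinates are unchanged. $\tilde e_0$: - $(E_1)$: $b_1-1$. - $(E_2)$: $b_3-1,\ \bar b_3-1,\ \bar b_1+1$. - $(E_3)$ and $z_4=-\frac13$: $b_2-\frac23,\ b_3-\frac23,\ \bar b_3+\frac43,\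 \bar b_2+\frac13$. - $(E_3)$ and $z_4=-\frac23$: $b_2-\frac13,\ b_3-\frac43,\ \bar b_3+\frac23,\ \bar b_2+\frac23$. - $(E_3)$ and $z_4\ne-\frac13,-\frac23$: $b_3-2,\ \bar b_2+1$. - $(E_4)$: $b_2-1,\ \bar b_3+2$. - $(E_5)$: $b_1-1,\ b_3+1,\ \bar b_3+1$. - $(E_6)$: $\bar b_1+1$. $\tilde f_0$: - $(F_1)$: $b_1+1$. - $(F_2)$: $b_3+1,\ \bar b_3+1,\ \bar b_1-1$. - $(F_3)$: $b_3+2,\ \bar b_2-1$. - $(F_4)$ and $z_4=\frac13$: $b_2+\frac13,\ b_3+\frac43,\ \bar b_3-\frac23,\ \bar b_2-\frac23$. - $(F_4)$ and $z_4=\frac23$: $b_2+\frac23,\ b_3+\frac23,\ \bar b_3-\frac43,\ \bar b_2-\frac13$. - $(F_4)$ and $z_4\ne\frac13,\frac23$: $b_2+1,\ \bar b_3-2$. - $(F_5)$: $b_1+1,\ b_3-1,\ \bar b_3-1$. - $(F_6)$: $\bar b_1-1$. $\tilde e_1$: - $\bar b_2+1,\ \bar b_1-1$ if $\bar b_2-\bar b_3\ge(b_2-b_3)_+$; - $b_3+1,\ \bar b_3-1$ if $\bar b_2-\bar b_3<0\le b_3-b_2$; - $b_1+1,\ b_2-1$ if $(\bar b_2-\bar b_3)_+<b_2-b_3$. $\tilde f_1$: - $b_1-1,\ b_2+1$ if $(\bar b_2-\bar b_3)_+\le b_2-b_3$; - $b_3-1,\ \bar b_3+1$ if $\bar b_2-\bar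 b_3\le0<b_3-b_2$; - $\bar b_2-1,\ \bar b_1+1$ if $\bar b_2-\bar b_3>(b_2-b_3)_+$. $\tilde e_2$: - $\bar b_3+\frac23,\ \bar b_2-\frac13$ if $\bar b_3\ge b_3$; - $b_2+\frac13,\ b_3-\frac23$ if $\bar b_3<b_3$. $\tilde f_2$: - $b_2-\frac13,\ b_3+\frac23$ if $\bar b_3\le b_3$; - $\bar b_3-\frac23,\ \bar b_2+\frac13$ if $\bar b_3>b_3$. Functions: $$\varepsilon_1(b)=\bar b_1+(\bar b_3-\bar b_2+(b_2-b_3)_+)_+,\qquad \varphi_1(b)=b_1+(b_3-b_2+(\bar b_2-\bar b_3)_+)_+,$$ $$\varepsilon_2(b)=3\bar b_2+\tfrac32(b_3-\bar b_3)_+,\qquad \varphi_2(b)=3b_2+\tfrac32(\bar b_3-b_3)_+,$$ $$\varphi_0(b)=-s(b)+\max\mathcal A,\qquad \varepsilon_0(b)=-s(b)+\max \mathcal A-(2z_1+z_2+z_3+3z_4),$$ where $\mathcal A=(0,\ z_1,\ z_1+z_2,\ z_1+z_2+3z_4,\ z_1+z_2+z_3+3z_4,\ 2z_1+z_2+z_3+3z_4)$. The weight is $\mathrm{wt}(b)=\sum_{i=0}^2(\varphi_i(b)-\varepsilon_i(b))\Lambda_i\in P_{\rm cl}$. *)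

(* Defs.v *)
From HB Require Import structures.
From mathcomp Require Import all_boot all_order all_algebra.
From mathcomp Require Import fraction complex ring lra zify.
From mathcomp Require Import boolp classical_sets reals generic_quotient.
From mathcomp Require Import mpoly.

Set Implicit Arguments.
Unset Strict Implicit.
Unset Printing Implicit Defensive.

Import Order.TTheory GRing.Theory Num.Theory.
Local Open Scope ring_scope.

(* The field C(t), with t = 'X. *)
Notation ratt R := {fraction {poly R[i]}}.

(* The field of rational functions on (C^x)^k. *)
Notation ratfun R k := {fraction {mpoly (R[i])[k]}}.

Section UltraDiscretization.
Variables (R : realType) (k : nat).

Definition torus_coord (j : 'I_k) : ratfun R k := tofrac ('X_j).

(* In R[i], [0 <= a] means that a is real and nonnegative, so this says that
   every monomial occurring in P has a positive coefficient. *)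
Definition pos_mpoly (P : {mpoly (R[i])[k]}) : Prop :=
  P != 0 /\ (forall m, 0 <= P@_m).

(* Laurent monomials in a quotient can be cleared, so ordinary polynomials are
   enough. *)
Definition positive (f : ratfun R k) : Prop :=
  exists P Q, [/\ pos_mpoly P, pos_mpoly Q & f = tofrac P / tofrac Q].

Definition mpoly_at (v : 'I_k -> ratt R) (P : {mpoly (R[i])[k]}) : ratt R :=
  mmap (@tofrac _ \o @polyC _) v P.

(* The value of f at a C(t)-point v of the torus: f is written as P / Q with
   Q(v) != 0 (the result is independent of P and Q, see [rat_atE]); it is 0 by
   convention if f is not regular at v. *)
Definition rat_at (v : 'I_k -> ratt R) (f : ratfun R k) : ratt R :=
  xget 0 [set w | exists P Q, [/\ mpoly_at v Q != 0,
                                  f = tofrac P / tofrac Q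
                                & w = mpoly_at v P / mpoly_at v Q]]%classic.

(* Order of the pole at t = oo: degree of the numerator minus degree of the
   denominator, for any way of writing f <> 0 as a fraction (see [deg_tE]). *)
Definition deg_t (f : ratt R) : int :=
  (size \n_(repr f))%:Z - (size \d_(repr f))%:Z.

Definition UD (f : ratfun R k) (m : 'rV[int]_k) : int :=
  deg_t (rat_at (fun j => (tofrac 'X : ratt R) ^ (m 0 j)) f).

End UltraDiscretization.

(* The data of a crystal of rank n on which all the Kashiwara operators are everywhere
   defined (no value 0).  A weight is given by its coordinates in the basis
   Lambda_0, ..., Lambda_(n-1) of P_cl. *)
Record crystal_data (n : nat) := Crystal {
  carrier :> Type;
  wt : carrier -> 'rV[int]_n;
  eps : 'I_n -> carrier -> int;
  phi : 'I_n -> carrier -> int;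
  ke : 'I_n -> carrier -> carrier;
  kf : 'I_n -> carrier -> carrier }.

Definition crystal_iso (n : nat) (A B : crystal_data n) (h : A -> B) : Prop :=
  bijective h /\
  (forall x : A, wt (h x) = wt x /\
   forall i : 'I_n, [/\ h (ke i x) = ke i (h x),
                        h (kf i x) = kf i (h x),
                        eps i (h x) = eps i x
                      & phi i (h x) = phi i x]).

Definition isomorphic (n : nat) (A B : crystal_data n) : Prop :=
  exists h : A -> B, crystal_iso h.

(* In [gc_e i j : ratfun R k.+1], the coordinate [ord0] is the parameter c of
   the action e_i^c and the coordinate [lift ord0 l] is x_l; [gc_e i j] is the
   j-th component of e_i^c(x). *)
Record positive_geom_data (R : realType) (n k : nat) := PositiveGeomData {
  gc_e : 'I_n -> 'I_k -> ratfun R k.+1;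
  gc_gamma : 'I_n -> ratfun R k;
  gc_eps : 'I_n -> ratfun R k;
  _ : forall i j, positive (gc_e i j);
  _ : forall i, positive (gc_gamma i);
  _ : forall i, positive (gc_eps i) }.

Section UDCrystal.
Variables (R : realType) (n k : nat) (X : positive_geom_data R n k).

Definition UD_action (i : 'I_n) (a : int) (x : 'rV[int]_k) : 'rV[int]_k :=
  \row_j UD (gc_e X i j) (row_mx (const_mx a : 'rV_1) x).

Definition UD_crystal : crystal_data n :=
  @Crystal n 'rV[int]_k
    (fun x => \row_i UD (gc_gamma X i) x)
    (fun i x => UD (gc_eps X i) x)
    (fun i x => UD (gc_eps X i) x + UD (gc_gamma X i) x)
    (fun i x => UD_action i 1 x)
    (fun i x => UD_action i (- 1) x).

End UDCrystal.

Section ChiFormulas.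
Variable F : fieldType.

Definition row6 (a0 a1 a2 a3 a4 a5 : F) : 'rV[F]_6 :=
  \row_(j < 6) [:: a0; a1; a2; a3; a4; a5]`_j.

Variables (c : F) (x : 'rV[F]_6).

Let x0 := x 0 (inord 0).
Let x1 := x 0 (inord 1).
Let x2 := x 0 (inord 2).
Let x3 := x 0 (inord 3).
Let x4 := x 0 (inord 4).
Let x5 := x 0 (inord 5).

Definition chi_gamma (i : 'I_3) : F :=
  match val i with
  | 0%N => x0 ^+ 2 / (x1 * x3 * x5)
  | 1%N => (x1 ^+ 2 * x3 ^+ 2 * x5 ^+ 2) / (x0 * x2 * x4)
  | _ => (x2 ^+ 2 * x4 ^+ 2) / (x1 ^+ 3 * x3 ^+ 3 * x5 ^+ 3)
  end.

Let A1 := x0 / x1.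
Let A2 := (x0 * x2) / (x1 ^+ 2 * x3).
Let A3 := (x0 * x2 * x4) / (x1 ^+ 2 * x3 ^+ 2 * x5).
Let B1 := x1 ^+ 3 / x2.
Let B2 := (x1 ^+ 3 * x3 ^+ 3) / (x2 ^+ 2 * x4).
Let p1 := x0 ^+ 2 * x2 * x3.
Let p2 := x1 * x2 * x3 ^+ 2 * x5.
Let p3 := x0 * x1 * x3 ^+ 3.
Let p4 := x0 * x2 * x3 ^+ 2.
Let p5 := x0 * x1 * x2 * x4.
Let p6 := x0 * x1 * x2 * x3 * x5.
Let E := p1 + p2 + p3 + p4 + p5 + p6.

Definition chi_eps (i : 'I_3) : F :=
  match val i with
  | 0%N => E / (x0 ^+ 3 * x2 * x3)
  | 1%N => A1 + A2 + A3
  | _ => B1 + B2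
  end.

Definition chi_e1 : 'rV[F]_6 :=
  let C1 := (c * A1 + A2 + A3) / (A1 + A2 + A3) in
  let C3 := (c * A1 + c * A2 + A3) / (c * A1 + A2 + A3) in
  let C5 := (c * (A1 + A2 + A3)) / (c * A1 + c * A2 + A3) in
  row6 x0 (C1 * x1) x2 (C3 * x3) x4 (C5 * x5).

Definition chi_e2 : 'rV[F]_6 :=
  let C2 := (c * B1 + B2) / (B1 + B2) in
  let C4 := (c * (B1 + B2)) / (c * B1 + B2) in
  row6 x0 x1 (C2 * x2) x3 (C4 * x4) x5.

Definition chi_e0 : 'rV[F]_6 :=
  let D := c ^+ 2 * p1 + p2 + c * (p3 + p4 + p5 + p6) in
  let F' := p2 + p4 + c * (p1 + p3 + p5 + p6) in
  let H := c * p1 + p2 + p3 + p4 + p5 + c * p6 in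
  let L := c * p1 + p2 + p4 + c * p6 in
  let G := L ^+ 3 + 3%:R * L ^+ 2 * (p3 + c * p5)
           + 3%:R * L * (p3 + p5) * (p3 + c ^+ 2 * p5)
           + (p3 + p5) ^+ 2 * (p3 + c ^+ 3 * p5) in
  row6 (D / (c * E) * x0)
       (F' / (c * E) * x1)
       (G / (c ^+ 3 * E ^+ 3) * x2)
       ((D * H) / (c ^+ 2 * E * F') * x3)
       (D ^+ 3 / (c ^+ 3 * G) * x4)
       (D / (c * H) * x5).

Definition chi_e (i : 'I_3) : 'rV[F]_6 :=
  match val i with
  | 0%N => chi_e0
  | 1%N => chi_e1
  | _ => chi_e2
  end.

End ChiFormulas.

Section WellDefinedness.
Variables (R : realType) (k : nat).
Implicit Types (P Q : {mpoly (R[i])[k]}) (v : 'I_k -> ratt R).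
Implicit Types (f g : ratfun R k).

Lemma mpoly_at0 v : mpoly_at v 0 = 0.
Proof. exact: mmap0. Qed.

Lemma mpoly_atM v P Q : mpoly_at v (P * Q) = mpoly_at v P * mpoly_at v Q.
Proof. exact: rmorphM. Qed.

Lemma rat_atE v f P Q : mpoly_at v Q != 0 -> f = tofrac P / tofrac Q ->
  rat_at v f = mpoly_at v P / mpoly_at v Q.
Proof.
move=> vQ0 fE; rewrite /rat_at; case: xgetP => [w _ [P' [Q' [vQ'0 fE' ->]]]|]; last first.
  by move=> /(_ (mpoly_at v P / mpoly_at v Q)); case; exists P, Q; split.
have nz (T : {mpoly (R[i])[k]}) : mpoly_at v T != 0 -> tofrac T != 0.
  by apply: contraNneq => /eqP; rewrite tofrac_eq0 => /eqP ->; rewrite mpoly_at0.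
have PQE : P' * Q = P * Q'.
  apply/eqP; rewrite -tofrac_eq !tofracM -eqr_div ?nz //.
  by rewrite -fE -fE'.
apply/eqP; rewrite (eqr_div _ _ vQ'0 vQ0); apply/eqP.
by rewrite -(mpoly_atM v P') -(mpoly_atM v P) PQE.
Qed.

Lemma frac_numden (A : idomainType) (f : {fraction A}) :
  f = tofrac \n_(repr f) / tofrac \d_(repr f).
Proof.
have d0 : \d_(repr f) != 0 by exact: denom_ratioP.
rewrite -{1}(reprK f) -{1}(Ratio_numden (repr f)).
move: (\n_(repr f)) (\d_(repr f)) d0 => n d d0.
unlock tofrac.
have E : FracField.mulf (Ratio n 1) (FracField.invf (Ratio d 1)) = Ratio n d.
  rewrite /FracField.mulf /FracField.invf !numden_Ratio ?oner_neq0 //.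
  by rewrite mulr1 mul1r.
by rewrite -E FracField.pi_mul FracField.pi_inv.
Qed.

Lemma deg_tE (a b : {poly R[i]}) : a != 0 -> b != 0 ->
  deg_t (tofrac a / tofrac b : ratt R) = (size a)%:Z - (size b)%:Z.
Proof.
move=> a0 b0; set f := (X in deg_t X); rewrite /deg_t.
set n := \n_(repr f); set d := \d_(repr f).
have d0 : d != 0 by exact: denom_ratioP.
have fE : f = tofrac n / tofrac d by exact: frac_numden.
have eq : n * b = a * d.
  apply/eqP; rewrite -tofrac_eq !rmorphM /= -eqr_div ?tofrac_eq0 //.
  by rewrite -fE.
have n0 : n != 0.
  by apply: contra_neq (mulf_neq0 a0 d0) => n0; rewrite -eq n0 mul0r.
have := congr1 (fun p : {poly R[i]} => size p) eq.
rewrite !size_mul // => szE.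
have [sn sd] : (0 < size n /\ 0 < size d)%N by rewrite !size_poly_gt0.
have [sa sb] : (0 < size a /\ 0 < size b)%N by rewrite !size_poly_gt0.
move: (size n) (size d) (size a) (size b) szE sn sd sa sb; clear; lia.
Qed.

Lemma pos_mpolyD P Q : pos_mpoly P -> pos_mpoly Q -> pos_mpoly (P + Q).
Proof.
move=> [P0 Pp] [Q0 Qp]; split=> [|m]; last by rewrite mcoeffD addr_ge0.
apply: contraNneq P0 => PQ0; apply/eqP/mpolyP => m; rewrite mcoeff0.
have /eqP : (P + Q)@_m = 0 by rewrite PQ0 mcoeff0.
by rewrite mcoeffD paddr_eq0 // => /andP[/eqP].
Qed.

Lemma pos_mpolyM P Q : pos_mpoly P -> pos_mpoly Q -> pos_mpoly (P * Q).
Proof.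
move=> [P0 Pp] [Q0 Qp]; split=> [|m]; first by rewrite mulf_neq0.
by rewrite mcoeffM; apply: sumr_ge0 => ? _; rewrite mulr_ge0.
Qed.

Lemma pos_mpolyX m : pos_mpoly ('X_[m] : {mpoly (R[i])[k]}).
Proof.
split=> [|m']; last by rewrite mcoeffX ler0n.
apply/eqP => /(congr1 (mcoeff m)) /eqP.
by rewrite mcoeffX eqxx mcoeff0 oner_eq0.
Qed.

Lemma positive1 : positive (1 : ratfun R k).
Proof.
exists 1, 1; rewrite divr1 rmorph1 -mpolyX0; split=> //; exact: pos_mpolyX.
Qed.

Lemma positive_coord (j : 'I_k) : positive (torus_coord R j).
Proof.
exists 'X_j, 1; rewrite rmorph1 divr1 -{1}mpolyX0.
by split=> //; exact: pos_mpolyX.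
Qed.

Lemma positiveD f g : positive f -> positive g -> positive (f + g).
Proof.
move=> [P [Q [pP pQ ->]]] [P' [Q' [pP' pQ' ->]]].
exists (P * Q' + P' * Q), (Q * Q'); split; [| exact: pos_mpolyM |].
  by apply: pos_mpolyD; exact: pos_mpolyM.
have [[Q0 _] [Q'0 _]] := (pQ, pQ').
by rewrite addf_div ?tofrac_eq0 // rmorphD !rmorphM.
Qed.

Lemma positiveM f g : positive f -> positive g -> positive (f * g).
Proof.
move=> [P [Q [pP pQ ->]]] [P' [Q' [pP' pQ' ->]]].
exists (P * P'), (Q * Q'); split; [exact: pos_mpolyM | exact: pos_mpolyM |].
by rewrite !rmorphM /= mulf_div.
Qed.

Lemma positiveV f : positive f -> positive f^-1.
Proof.
by move=> [P [Q [pP pQ ->]]]; exists Q, P; split=> //; rewrite invf_div.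
Qed.

End WellDefinedness.

(* Stated for an abstract field and predicate: unification is much slower on
   the concrete field of rational functions. *)
Section ChiClosed.
Variables (F : fieldType) (pos : F -> Prop).
Hypotheses (pos1 : pos 1) (posD : forall u v, pos u -> pos v -> pos (u + v))
  (posM : forall u v, pos u -> pos v -> pos (u * v))
  (posV : forall u, pos u -> pos u^-1).

Let posX u n : pos u -> pos (u ^+ n).
Proof.
by move=> pu; elim: n => [|n IH]; rewrite ?expr0 ?exprS //; exact: posM.
Qed.

Let pos3 : pos 3%:R.
Proof. by rewrite -!natr1 mulr0n add0r; do !apply: posD. Qed.

Variables (c : F) (x : 'rV[F]_6).
Hypotheses (posc : pos c) (posx : forall j, pos (x 0 j)).

Local Ltac positivity :=
  repeat match goal with
  | |- pos (_ + _) => apply: posD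
  | |- pos (_ * _) => apply: posM
  | |- pos (_ ^-1) => apply: posV
  | |- pos (_ ^+ _) => apply: posX
  | |- pos (3%:R) => exact: pos3
  | |- _ => first [exact: posx | exact: posc]
  end.

Lemma chi_e_closed i j : pos (chi_e c x i 0 j).
Proof.
case: i => -[|[|[|//]]] ?; case: j => -[|[|[|[|[|[|//]]]]]] ?;
rewrite /chi_e /chi_e0 /chi_e1 /chi_e2 /row6 !mxE; cbn [nth val nat_of_ord];
positivity.
Qed.

Lemma chi_gamma_closed i : pos (chi_gamma x i).
Proof using pos1 posD posM posV posx. by case: i => -[|[|[|//]]] ?; rewrite /chi_gamma /=; positivity. Qed.

Lemma chi_eps_closed i : pos (chi_eps x i).
Proof using pos1 posD posM posV posx. by case: i => -[|[|[|//]]] ?; rewrite /chi_eps /=; positivity. Qed.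

End ChiClosed.

Section Chi.
Variable R : realType.

Let point6 : 'rV[ratfun R 6]_6 := \row_j torus_coord R j.
Let point7 : 'rV[ratfun R 7]_6 := \row_j torus_coord R (lift ord0 j).

Definition chi_e_rat (i : 'I_3) (j : 'I_6) : ratfun R 7 :=
  chi_e (torus_coord R ord0) point7 i 0 j.
Definition chi_gamma_rat (i : 'I_3) : ratfun R 6 := chi_gamma point6 i.
Definition chi_eps_rat (i : 'I_3) : ratfun R 6 := chi_eps point6 i.

Lemma chi_e_positive i j : positive (chi_e_rat i j).
Proof.
apply: chi_e_closed; [exact: positive1 | exact: positiveD | exact: positiveM
  | exact: positiveV | exact: positive_coord | by move=> ?; rewrite mxE; exact: positive_coord].
Qed.

Lemma chi_gamma_positive i : positive (chi_gamma_rat i).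
Proof.
apply: chi_gamma_closed; [exact: positive1 | exact: positiveD | exact: positiveM
  | exact: positiveV | by move=> ?; rewrite mxE; exact: positive_coord].
Qed.

Lemma chi_eps_positive i : positive (chi_eps_rat i).
Proof.
apply: chi_eps_closed; [exact: positive1 | exact: positiveD | exact: positiveM
  | exact: positiveV | by move=> ?; rewrite mxE; exact: positive_coord].
Qed.

Definition chi : positive_geom_data R 3 6 :=
  PositiveGeomData chi_e_positive chi_gamma_positive chi_eps_positive.

End Chi.

(* [cb1], [cb2], [cb3] are the barred coordinates. *)
Record coords := Coords { b1 : rat; b2 : rat; b3 : rat;
                          cb3 : rat; cb2 : rat; cb1 : rat }.

Definition shift (b d : coords) : coords :=
  Coords (b1 b + b1 d) (b2 b + b2 d) (b3 b + b3 d)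
         (cb3 b + cb3 d) (cb2 b + cb2 d) (cb1 b + cb1 d).

(* The congruence 3 b3 = 3 cb3 mod 2 is the condition on the half difference. *)
Definition in_Binf (b : coords) : bool :=
  [&& [&& 3 * b1 b \is a Num.int, 3 * b2 b \is a Num.int,
          3 * b3 b \is a Num.int, 3 * cb3 b \is a Num.int,
          3 * cb2 b \is a Num.int & 3 * cb1 b \is a Num.int],
      (3 * b3 b - 3 * cb3 b) / 2 \is a Num.int,
      b1 b \is a Num.int, cb1 b \is a Num.int,
      b2 b - b3 b \is a Num.int & cb3 b - cb2 b \is a Num.int].

Definition Binf_set : Type := {b : coords | in_Binf b}.

Section BinfOperators.
Variable b : coords.

Let b1 := b1 b.
Let b2 := b2 b.
Let b3 := b3 b.
Let cb3 := cb3 b.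
Let cb2 := cb2 b.
Let cb1 := cb1 b.

Let pp (y : rat) : rat := Num.max y 0.

Let s := b1 + b2 + (b3 + cb3) / 2 + cb2 + cb1.
Let z1 := cb1 - b1.
Let z2 := cb2 - cb3.
Let z3 := b3 - b2.
Let z4 := (cb3 - b3) / 2.

Definition cond (gt0 le0 : pred rat) (l : nat) : bool :=
  match l with
  | 1%N => [&& le0 (z1 + z2 + z3 + 3 * z4), le0 (z1 + z2 + 3 * z4),
               le0 (z1 + z2) & le0 z1]
  | 2%N => [&& le0 (z1 + z2 + z3 + 3 * z4), le0 (z2 + 3 * z4),
               le0 z2 & gt0 z1]
  | 3%N => [&& le0 (z1 + z3 + 3 * z4), le0 (z3 + 3 * z4), le0 z4,
               gt0 z2 & gt0 (z1 + z2)]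
  | 4%N => [&& gt0 (z1 + z2 + 3 * z4), gt0 (z2 + 3 * z4), gt0 z4,
               le0 z3 & le0 (z1 + z3)]
  | 5%N => [&& gt0 (z1 + z2 + z3 + 3 * z4), gt0 (z3 + 3 * z4),
               gt0 z3 & le0 z1]
  | 6%N => [&& gt0 (z1 + z2 + z3 + 3 * z4), gt0 (z1 + z3 + 3 * z4),
               gt0 (z1 + z3) & gt0 z1]
  | _ => false
  end.

Definition condF := cond (fun y => 0 < y) (fun y => y <= 0).
Definition condE := cond (fun y => 0 <= y) (fun y => y < 0).

(* The case conditions of each operator are exhaustive and mutually exclusive,
   so the final default and the order of the tests are irrelevant. *)
Definition no_move := Coords 0 0 0 0 0 0.

Definition move_e0 : coords :=
  if condE 1 then Coords (-1) 0 0 0 0 0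
  else if condE 2 then Coords 0 0 (-1) (-1) 0 1
  else if condE 3 then
    if z4 == - (1 / 3) then Coords 0 (- (2 / 3)) (- (2 / 3)) (4 / 3) (1 / 3) 0
    else if z4 == - (2 / 3) then
      Coords 0 (- (1 / 3)) (- (4 / 3)) (2 / 3) (2 / 3) 0
    else Coords 0 0 (-2) 0 1 0
  else if condE 4 then Coords 0 (-1) 0 2 0 0
  else if condE 5 then Coords (-1) 0 1 1 0 0
  else if condE 6 then Coords 0 0 0 0 0 1
  else no_move.

Definition move_f0 : coords :=
  if condF 1 then Coords 1 0 0 0 0 0
  else if condF 2 then Coords 0 0 1 1 0 (-1)
  else if condF 3 then Coords 0 0 2 0 (-1) 0
  else if condF 4 then
    if z4 == 1 / 3 then Coords 0 (1 / 3) (4 / 3) (- (2 / 3)) (- (2 / 3)) 0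
    else if z4 == 2 / 3 then
      Coords 0 (2 / 3) (2 / 3) (- (4 / 3)) (- (1 / 3)) 0
    else Coords 0 1 0 (-2) 0 0
  else if condF 5 then Coords 1 0 (-1) (-1) 0 0
  else if condF 6 then Coords 0 0 0 0 0 (-1)
  else no_move.

Definition move_e1 : coords :=
  if cb2 - cb3 >= pp (b2 - b3) then Coords 0 0 0 0 1 (-1)
  else if cb2 - cb3 < 0 <= b3 - b2 then Coords 0 0 1 (-1) 0 0
  else if pp (cb2 - cb3) < b2 - b3 then Coords 1 (-1) 0 0 0 0
  else no_move.

Definition move_f1 : coords :=
  if pp (cb2 - cb3) <= b2 - b3 then Coords (-1) 1 0 0 0 0
  else if cb2 - cb3 <= 0 < b3 - b2 then Coords 0 0 (-1) 1 0 0
  else if cb2 - cb3 > pp (b2 - b3) then Coords 0 0 0 0 (-1) 1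
  else no_move.

Definition move_e2 : coords :=
  if cb3 >= b3 then Coords 0 0 0 (2 / 3) (- (1 / 3)) 0
  else Coords 0 (1 / 3) (- (2 / 3)) 0 0 0.

Definition move_f2 : coords :=
  if cb3 <= b3 then Coords 0 (- (1 / 3)) (2 / 3) 0 0 0
  else Coords 0 0 0 (- (2 / 3)) (1 / 3) 0.

Definition move_e (i : 'I_3) : coords :=
  match val i with 0%N => move_e0 | 1%N => move_e1 | _ => move_e2 end.

Definition move_f (i : 'I_3) : coords :=
  match val i with 0%N => move_f0 | 1%N => move_f1 | _ => move_f2 end.

Let maxA : rat :=
  foldr Num.max 0 [:: z1; z1 + z2; z1 + z2 + 3 * z4;
                      z1 + z2 + z3 + 3 * z4; 2 * z1 + z2 + z3 + 3 * z4].

Definition Beps_rat (i : 'I_3) : rat :=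
  match val i with
  | 0%N => - s + maxA - (2 * z1 + z2 + z3 + 3 * z4)
  | 1%N => cb1 + pp (cb3 - cb2 + pp (b2 - b3))
  | _ => 3 * cb2 + 3 / 2 * pp (b3 - cb3)
  end.

Definition Bphi_rat (i : 'I_3) : rat :=
  match val i with
  | 0%N => - s + maxA
  | 1%N => b1 + pp (b3 - b2 + pp (cb2 - cb3))
  | _ => 3 * b2 + 3 / 2 * pp (cb3 - b3)
  end.

End BinfOperators.

Lemma in_Binf_shift b d : in_Binf b -> in_Binf d -> in_Binf (shift b d).
Proof.
rewrite /in_Binf; cbn [shift b1 b2 b3 cb3 cb2 cb1].
move=> /and5P[/and5P[h1 h2 h3 h4 /andP[h5 h6]] h7 h8 h9 /andP[h10 h11]].
move=> /and5P[/and5P[k1 k2 k3 k4 /andP[k5 k6]] k7 k8 k9 /andP[k10 k11]].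
rewrite !mulrDr.
rewrite !(rpredD h1 k1, rpredD h2 k2, rpredD h3 k3, rpredD h4 k4, rpredD h5 k5,
          rpredD h6 k6, rpredD h8 k8, rpredD h9 k9) /=.
have int_eq (u v : rat) : u = v -> u \is a Num.int -> v \is a Num.int.
  by move=> ->.
apply/and3P; split.
- by apply: (int_eq _ _ _ (rpredD h7 k7)); field.
- by apply: (int_eq _ _ _ (rpredD h10 k10)); field.
- by apply: (int_eq _ _ _ (rpredD h11 k11)); field.
Qed.

Lemma in_Binf_move_e b i : in_Binf (move_e b i).
Proof.
case: i => -[|[|[|//]]] ?; rewrite /move_e /= ?/move_e0 ?/move_e1 ?/move_e2;
by repeat case: ifP => _.
Qed.

Lemma in_Binf_move_f b i : in_Binf (move_f b i).
Proof.
case: i => -[|[|[|//]]] ?; rewrite /move_f /= ?/move_f0 ?/move_f1 ?/move_f2;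
by repeat case: ifP => _.
Qed.

Definition Binf_e (i : 'I_3) (b : Binf_set) : Binf_set :=
  exist _ (shift (val b) (move_e (val b) i))
    (in_Binf_shift (valP b) (in_Binf_move_e (val b) i)).

Definition Binf_f (i : 'I_3) (b : Binf_set) : Binf_set :=
  exist _ (shift (val b) (move_f (val b) i))
    (in_Binf_shift (valP b) (in_Binf_move_f (val b) i)).

(* [Beps_rat] and [Bphi_rat] take integer values on B_oo, see [Binf_epsE] and
   [Binf_phiE]; the floor only changes the type of these values. *)
Definition Binf_eps (i : 'I_3) (b : Binf_set) : int :=
  Num.floor (Beps_rat (val b) i).

Definition Binf_phi (i : 'I_3) (b : Binf_set) : int :=
  Num.floor (Bphi_rat (val b) i).

Lemma max_int (u v : rat) :
  u \is a Num.int -> v \is a Num.int -> Num.max u v \is a Num.int.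
Proof. by rewrite maxEle; case: ifP. Qed.

Local Ltac integrality :=
  repeat first [assumption | exact: rpred0 | exact: rpred_nat
    | apply: max_int | apply: rpredD | rewrite rpredN | apply: rpredM].

Section Integrality.
Variable b : coords.
Hypothesis hb : in_Binf b.

Let s_int : b1 b + b2 b + (b3 b + cb3 b) / 2 + cb2 b + cb1 b \is a Num.int.
Proof.
move: hb; rewrite /in_Binf => /and5P[/and5P[_ _ _ h4 _] h7 h8 h9 /andP[h10 h11]].
rewrite (_ : _ + cb1 b = b1 b + (b2 b - b3 b) + (3 * b3 b - 3 * cb3 b) / 2
  + 3 * cb3 b - (cb3 b - cb2 b) + cb1 b); last by field.
integrality.
Qed.

Let z_int : [/\ cb1 b - b1 b \is a Num.int, cb2 b - cb3 b \is a Num.int,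
  b3 b - b2 b \is a Num.int & 3 * ((cb3 b - b3 b) / 2) \is a Num.int].
Proof.
move: hb; rewrite /in_Binf => /and5P[_ h7 h8 h9 /andP[h10 h11]].
split; [exact: rpredB | by rewrite -opprB rpredN | by rewrite -opprB rpredN |].
by rewrite (_ : _ * _ = - ((3 * b3 b - 3 * cb3 b) / 2)) ?rpredN //; field.
Qed.

Let half_int (u v : rat) : u \is a Num.int ->
  3 * (v / 2) \is a Num.int -> u + 3 / 2 * Num.max v 0 \is a Num.int.
Proof.
move=> hu hv; rewrite rpredD // maxEle; case: ifP => _; first by rewrite mulr0.
by rewrite (_ : 3 / 2 * v = 3 * (v / 2)) //; field.
Qed.

Lemma Beps_rat_int i : Beps_rat b i \is a Num.int.
Proof.
have [h1 h2 h3 h4] := z_int; move: (hb); rewrite /in_Binf.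
move=> /and5P[/and5P[_ _ _ _ /andP[h5 h6]] h7 h8 h9 /andP[h10 h11]].
have h2' : b2 b - b3 b \is a Num.int by rewrite -rpredN opprB.
have h4' : 3 * ((b3 b - cb3 b) / 2) \is a Num.int.
  by rewrite (_ : _ * _ = - (3 * ((cb3 b - b3 b) / 2))) ?rpredN //; field.
case: i => -[|[|[|//]]] ?; rewrite /Beps_rat /=; last exact: half_int.
- integrality.
- integrality.
Qed.

Lemma Bphi_rat_int i : Bphi_rat b i \is a Num.int.
Proof.
have [h1 h2 h3 h4] := z_int; move: (hb); rewrite /in_Binf.
move=> /and5P[/and5P[_ h0 _ _ _] h7 h8 h9 /andP[h10 h11]].
case: i => -[|[|[|//]]] ?; rewrite /Bphi_rat /=; last exact: half_int.
- integrality.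
- integrality.
Qed.

End Integrality.

Lemma Binf_epsE i b : (Binf_eps i b)%:~R = Beps_rat (val b) i.
Proof.
by apply: floorK; exact: (Beps_rat_int (valP b)).
Qed.

Lemma Binf_phiE i b : (Binf_phi i b)%:~R = Bphi_rat (val b) i.
Proof.
by apply: floorK; exact: (Bphi_rat_int (valP b)).
Qed.

Definition Binf : crystal_data 3 :=
  @Crystal 3 Binf_set
    (fun b => \row_i (Binf_phi i b - Binf_eps i b))
    Binf_eps Binf_phi Binf_e Binf_f.

(* Main.v *)
Require Import Defs.
From mathcomp Require Import all_boot all_order all_algebra reals.
From mathcomp Require Import fraction complex ring lra zify mpoly.

(** An element of C(t) that is a quotient of polynomials with positive leading
coefficients has a degree that turns +, *, ^-1 into max, +, -: no cancellation
of leading terms can occur.  Hence UD of the explicit formulas of chi is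
obtained by tropicalizing them term by term.  The isomorphism is the linear map
  b1 = x5, b2 = x4/3 - x5, b3 = x3 - 2 x4/3,
  cb3 = 2 x2/3 - x3, cb2 = x1 - x2/3, cb1 = x0 - x1,
which is read off by matching the terms of UD(eps_1), UD(eps_2) and UD(phi_1)
with those of eps_1, eps_2 and phi_1 on B_oo.  Under it, z1, z1 + z2,
z1 + z2 + 3 z4, z1 + z2 + z3 + 3 z4, 2 z1 + z2 + z3 + 3 z4 are the differences
with p2 of the exponents of p4, p3, p5, p6, p1, so that the conditions
(F_1), ..., (F_6) and (E_1), ..., (E_6) say which of p2, p4, p3, p5, p6, p1 is
the leading term of E.  In each of these cones D, E, F, H are linear;
G is too, except when p3 and p5 are close, which produces the exceptional cases
z4 = 1/3, 2/3 up to sign. *)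

Set Implicit Arguments.
Unset Strict Implicit.
Unset Printing Implicit Defensive.

Import Order.TTheory GRing.Theory Num.Theory.
Local Open Scope ring_scope.

(** * Polynomials with positive leading coefficient *)

Lemma lead_coef_gt0D (F : numDomainType) (p q : {poly F}) :
  0 < lead_coef p -> 0 < lead_coef q ->
  0 < lead_coef (p + q) /\ size (p + q) = maxn (size p) (size q).
Proof.
move=> p_gt0 q_gt0; case: (ltngtP (size p) (size q)) => [lt_pq|lt_qp|eq_pq].
- by rewrite addrC lead_coefDl // size_polyDl.
- by rewrite lead_coefDl // size_polyDl.
(* For equal sizes the two top coefficients add up to a positive number, so the size does not
   drop. *)
have nz : (p + q)`_(size p).-1 > 0.
  by rewrite coefD {2}eq_pq -!lead_coefE addr_gt0.
have szE : size (p + q) = size p.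
  apply/anti_leq; apply/andP; split.
    by rewrite -[X in (_ <= X)%N](maxnn (size p)) {2}eq_pq size_polyD.
  rewrite -(@prednK (size p)); last first.
    rewrite size_poly_gt0.
  by apply: contraTneq p_gt0 => ->; rewrite lead_coef0 ltxx.
  by rewrite ltnNge; apply: contraTN nz => /(nth_default 0) ->; rewrite ltxx.
by rewrite lead_coefE szE.
Qed.

(** * Values of fractions at a point, as a relation *)

Section Specialization.
Variables (A : comNzRingType) (K L : fieldType).
Variables (iota : {rmorphism A -> K}) (ev : {rmorphism A -> L}).
Hypothesis iota_neq0 : forall P, ev P != 0 -> iota P != 0.

(** [rat_at] is defined by choice and does not compute; this relation can be followed through sums,
    products and inverses, and [rat_atE] turns it back into a value. *)
Definition specializes (f : K) (w : L) : Prop :=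
  exists P Q, [/\ ev Q != 0, f = iota P / iota Q & w = ev P / ev Q].

Lemma specializes_ring P : specializes (iota P) (ev P).
Proof. by exists P, 1; rewrite !rmorph1 oner_neq0 !divr1. Qed.

Lemma specializesM f g u w :
  specializes f u -> specializes g w -> specializes (f * g) (u * w).
Proof.
move=> [P [Q [Q0 -> ->]]] [P' [Q' [Q'0 -> ->]]].
by exists (P * P'), (Q * Q'); rewrite !rmorphM mulf_neq0 //= !mulf_div.
Qed.

Lemma specializesD f g u w :
  specializes f u -> specializes g w -> specializes (f + g) (u + w).
Proof.
move=> [P [Q [Q0 -> ->]]] [P' [Q' [Q'0 -> ->]]].
exists (P * Q' + P' * Q), (Q * Q').
by rewrite !rmorphD !rmorphM mulf_neq0 //= !addf_div ?iota_neq0.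
Qed.

Lemma specializesV f w : w != 0 -> specializes f w -> specializes f^-1 w^-1.
Proof.
move=> w0 [P [Q [Q0 -> wE]]]; exists Q, P; rewrite wE !invf_div; split=> //.
by apply: contraNneq w0 => P0; rewrite wE P0 mul0r.
Qed.

End Specialization.

(** * Degrees at infinity and the term-by-term calculus of [UD] *)

Section Tropicalization.
Variables (R : realType) (k : nat).

(** Only leading coefficients are constrained: this already excludes cancellation at infinity. Sizes
    replace degrees, as the shift by one cancels in the difference. *)
Definition pos_deg (w : ratt R) (d : int) : Prop :=
  exists a b : {poly R[i]}, [/\ 0 < lead_coef a, 0 < lead_coef b,
    w = tofrac a / tofrac b & d = (size a)%:Z - (size b)%:Z].

Let nz_lead (a : {poly R[i]}) : 0 < lead_coef a -> a != 0.
Proof. by apply: contraTneq => ->; rewrite lead_coef0 ltxx. Qed.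

Lemma pos_deg_neq0 w d : pos_deg w d -> w != 0.
Proof.
move=> [a [b [/nz_lead a0 /nz_lead b0 -> _]]].
by rewrite mulf_neq0 ?invr_neq0 ?tofrac_eq0.
Qed.

Lemma pos_degE w d : pos_deg w d -> deg_t w = d.
Proof. by move=> [a [b [/nz_lead a0 /nz_lead b0 -> ->]]]; apply: deg_tE. Qed.

Lemma pos_deg_poly (a : {poly R[i]}) :
  0 < lead_coef a -> pos_deg (tofrac a) ((size a)%:Z - 1).
Proof.
by move=> a0; exists a, 1; rewrite lead_coef1 ltr01 tofrac1 divr1 size_poly1.
Qed.

Lemma pos_deg1 : pos_deg 1 0.
Proof.
have := @pos_deg_poly 1; rewrite lead_coef1 tofrac1 size_poly1 subrr.
exact.
Qed.

Lemma pos_degM w w' d d' :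
  pos_deg w d -> pos_deg w' d' -> pos_deg (w * w') (d + d').
Proof.
move=> [a [b [a0 b0 -> ->]]] [a' [b' [a'0 b'0 -> ->]]].
exists (a * a'), (b * b'); rewrite !lead_coefM !mulr_gt0 //; split=> //.
  by rewrite !rmorphM /= mulf_div.
rewrite !size_mul ?nz_lead //.
have := nz_lead a0; have := nz_lead b0.
have := nz_lead a'0; have := nz_lead b'0.
rewrite -!size_poly_gt0.
move: (size a) (size a') (size b) (size b') => m n p q; clear; lia.
Qed.

Lemma pos_degV w d : pos_deg w d -> pos_deg w^-1 (- d).
Proof.
move=> [a [b [a0 b0 -> ->]]]; exists b, a; split=> //.
  by rewrite invf_div.
by rewrite opprB.
Qed.

Lemma pos_degD w w' d d' :
  pos_deg w d -> pos_deg w' d' -> pos_deg (w + w') (Num.max d d').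
Proof.
move=> [a [b [a0 b0 -> ->]]] [a' [b' [a'0 b'0 -> ->]]].
have ab'0 : 0 < lead_coef (a * b') by rewrite lead_coefM mulr_gt0.
have a'b0 : 0 < lead_coef (a' * b) by rewrite lead_coefM mulr_gt0.
have [s0 ssz] := lead_coef_gt0D ab'0 a'b0.
exists (a * b' + a' * b), (b * b'); split=> //.
- by rewrite lead_coefM mulr_gt0.
- by rewrite addf_div ?tofrac_eq0 ?nz_lead // rmorphD !rmorphM.
rewrite ssz !size_mul ?nz_lead //.
have := nz_lead a0; have := nz_lead b0.
have := nz_lead a'0; have := nz_lead b'0.
rewrite -!size_poly_gt0.
move: (size a) (size a') (size b) (size b') => m n p q; clear; lia.
Qed.

Lemma pos_deg_Xexp (n : int) : pos_deg (tofrac 'X ^ n) n.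
Proof.
have posX j : pos_deg (tofrac 'X ^+ j) j%:Z.
  rewrite -rmorphXn /=.
  have := @pos_deg_poly 'X^j; rewrite lead_coefXn size_polyXn.
  by rewrite -addn1 PoszD addrK; apply.
by case: n => j; [exact: posX | rewrite NegzE -exprnN; exact: pos_degV].
Qed.

Variable m : 'rV[int]_k.
Let v : 'I_k -> ratt R := fun j => tofrac 'X ^ m 0 j.
Let iota : {rmorphism {mpoly (R[i])[k]} -> ratfun R k} :=
  @tofrac {mpoly (R[i])[k]}.
Let ev : {rmorphism {mpoly (R[i])[k]} -> ratt R} :=
  mmap (@tofrac _ \o @polyC _) v.

Let iota_neq0 P : ev P != 0 -> iota P != 0.
Proof.
by apply: contraNneq => /eqP; rewrite tofrac_eq0 => /eqP ->; rewrite rmorph0.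
Qed.

(** Stronger than [UD f m = d]: the value at the point has positive leading coefficients, so it is
    nonzero and can be inverted, and sums have the expected degree. *)
Definition trop (f : ratfun R k) (d : int) : Prop :=
  exists2 w, specializes iota ev f w & pos_deg w d.

Lemma trop_UD f d : trop f d -> UD f m = d.
Proof.
move=> [w [P [Q [Q0 fE wE]]] /pos_degE <-].
by rewrite /UD (rat_atE Q0 fE) wE.
Qed.

Lemma trop1 : trop 1 0.
Proof.
exists 1; last exact: pos_deg1.
by have := specializes_ring iota ev 1; rewrite !rmorph1.
Qed.

Lemma trop_coord j : trop (torus_coord R j) (m 0 j).
Proof.
exists (v j); last exact: pos_deg_Xexp.
by have := specializes_ring iota ev 'X_j; rewrite /= mmapX mmap1U.
Qed.

Lemma tropM f g d d' : trop f d -> trop g d' -> trop (f * g) (d + d').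
Proof.
move=> [u fu ud] [w gw wd]; exists (u * w); last exact: pos_degM.
exact: specializesM.
Qed.

Lemma tropD f g d d' : trop f d -> trop g d' -> trop (f + g) (Num.max d d').
Proof.
move=> [u fu ud] [w gw wd]; exists (u + w); last exact: pos_degD.
exact: specializesD.
Qed.

Lemma tropV f d : trop f d -> trop f^-1 (- d).
Proof.
move=> [w fw wd]; exists w^-1; last exact: pos_degV.
exact: specializesV (pos_deg_neq0 wd) fw.
Qed.

End Tropicalization.

(** * Tropical formulas of chi *)

Section TropicalChi.
Variables (c : int) (x : 'rV[int]_6).

Let x0 := x 0 (inord 0).
Let x1 := x 0 (inord 1).
Let x2 := x 0 (inord 2).
Let x3 := x 0 (inord 3).
Let x4 := x 0 (inord 4).
Let x5 := x 0 (inord 5).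

Definition trop_gamma (i : 'I_3) : int :=
  match val i with
  | 0%N => x0 *+ 2 - (x1 + x3 + x5)
  | 1%N => (x1 *+ 2 + x3 *+ 2 + x5 *+ 2) - (x0 + x2 + x4)
  | _ => (x2 *+ 2 + x4 *+ 2) - (x1 *+ 3 + x3 *+ 3 + x5 *+ 3)
  end.

Let A1 := x0 - x1.
Let A2 := (x0 + x2) - (x1 *+ 2 + x3).
Let A3 := (x0 + x2 + x4) - (x1 *+ 2 + x3 *+ 2 + x5).
Let B1 := x1 *+ 3 - x2.
Let B2 := (x1 *+ 3 + x3 *+ 3) - (x2 *+ 2 + x4).

Definition trop_p (l : nat) : int :=
  match l with
  | 1%N => x0 *+ 2 + x2 + x3
  | 2%N => x1 + x2 + x3 *+ 2 + x5
  | 3%N => x0 + x1 + x3 *+ 3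
  | 4%N => x0 + x2 + x3 *+ 2
  | 5%N => x0 + x1 + x2 + x4
  | _ => x0 + x1 + x2 + x3 + x5
  end.

Let p1 := trop_p 1.
Let p2 := trop_p 2.
Let p3 := trop_p 3.
Let p4 := trop_p 4.
Let p5 := trop_p 5.
Let p6 := trop_p 6.

Local Notation max := Num.max.

Definition trop_E := max (max (max (max (max p1 p2) p3) p4) p5) p6.
Definition trop_D :=
  max (max (c *+ 2 + p1) p2) (c + max (max (max p3 p4) p5) p6).
Definition trop_F := max (max p2 p4) (c + max (max (max p1 p3) p5) p6).
Definition trop_H := max (max (max (max (max (c + p1) p2) p3) p4) p5) (c + p6).
Definition trop_L := max (max (max (c + p1) p2) p4) (c + p6).
(** The summands [0] are the degrees of the constant 3; they are kept so that the expression has the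
    shape of G. *)
Definition trop_G :=
  max (max (max (trop_L *+ 3) (0 + trop_L *+ 2 + max p3 (c + p5)))
           (0 + trop_L + max p3 p5 + max p3 (c *+ 2 + p5)))
      (max p3 p5 *+ 2 + max p3 (c *+ 3 + p5)).

Definition trop_eps (i : 'I_3) : int :=
  match val i with
  | 0%N => trop_E - (x0 *+ 3 + x2 + x3)
  | 1%N => max (max A1 A2) A3
  | _ => max B1 B2
  end.

Definition trop_e (i : 'I_3) : 'rV[int]_6 :=
  \row_(j < 6) (match val i with
  | 0%N =>
    [:: trop_D - (c + trop_E) + x0;
        trop_F - (c + trop_E) + x1;
        trop_G - (c *+ 3 + trop_E *+ 3) + x2;
        (trop_D + trop_H) - (c *+ 2 + trop_E + trop_F) + x3;
        trop_D *+ 3 - (c *+ 3 + trop_G) + x4;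
        trop_D - (c + trop_H) + x5]
  | 1%N =>
    [:: x0; max (max (c + A1) A2) A3 - max (max A1 A2) A3 + x1; x2;
        max (max (c + A1) (c + A2)) A3 - max (max (c + A1) A2) A3 + x3; x4;
        c + max (max A1 A2) A3 - max (max (c + A1) (c + A2)) A3 + x5]
  | _ =>
    [:: x0; x1; max (c + B1) B2 - max B1 B2 + x2; x3;
        c + max B1 B2 - max (c + B1) B2 + x4; x5]
  end)`_j.

End TropicalChi.

(* Stated for an abstract field and relation, for the sake of unification. *)
Section TropicalizationOfChi.
Variables (K : fieldType) (tr : K -> int -> Prop).
Hypotheses (tr1 : tr 1 0)
  (trD : forall u v d e, tr u d -> tr v e -> tr (u + v) (Num.max d e))
  (trM : forall u v d e, tr u d -> tr v e -> tr (u * v) (d + e))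
  (trV : forall u d, tr u d -> tr u^-1 (- d)).

Let trX u d n : tr u d -> tr (u ^+ n) (d *+ n).
Proof.
by move=> ud; elim: n => [|n IH]; rewrite ?expr0 // exprS mulrS; exact: trM.
Qed.

Let tr3 : tr 3%:R 0.
Proof.
by have := trD (trD tr1 tr1) tr1; rewrite !maxxx -!natr1 mulr0n add0r.
Qed.

Variables (c : K) (x : 'rV[K]_6) (cd : int) (xd : 'rV[int]_6).
Hypotheses (trc : tr c cd) (trx : forall j, tr (x 0 j) (xd 0 j)).

Local Ltac tropicalize :=
  repeat match goal with
  | |- tr (_ + _) _ => apply: trD
  | |- tr (_ * _) _ => apply: trM
  | |- tr (_ ^-1) _ => apply: trV
  | |- tr (_ ^+ _) _ => apply: trX
  | |- tr (3%:R) _ => exact: tr3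
  | |- _ => first [exact: trx | exact: trc]
  end.

(** The integer formulas mirror the rational ones operation by operation, so the head symbol of the
    rational expression selects the rule to apply. *)
Lemma trop_e_correct i j : tr (chi_e c x i 0 j) (trop_e cd xd i 0 j).
Proof.
case: i => -[|[|[|//]]] ?; case: j => -[|[|[|[|[|[|//]]]]]] ?;
rewrite /chi_e /chi_e0 /chi_e1 /chi_e2 /trop_e /row6 !mxE;
cbn [nth val nat_of_ord isSub.val_subdef SubType.class]; tropicalize.
Qed.

Lemma trop_gamma_correct i : tr (chi_gamma x i) (trop_gamma xd i).
Proof using trM trV trx tr1.
by case: i => -[|[|[|//]]] ?; rewrite /chi_gamma /trop_gamma /=; tropicalize.
Qed.

Lemma trop_eps_correct i : tr (chi_eps x i) (trop_eps xd i).
Proof using trM trV trx trD tr1.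
by case: i => -[|[|[|//]]] ?; rewrite /chi_eps /trop_eps /=; tropicalize.
Qed.

End TropicalizationOfChi.

(** * Ultra-discretization of chi *)

Section UDChi.
Variables (R : realType) (x : 'rV[int]_6).

Let trop_coords j :
  trop x ((\row_j torus_coord R j : 'rV[ratfun R 6]_6) 0 j) (x 0 j).
Proof. rewrite mxE; exact: trop_coord. Qed.

Lemma UD_chi_gamma i : UD (gc_gamma (chi R) i) x = trop_gamma x i.
Proof.
apply: trop_UD; apply: trop_gamma_correct (trop_coords) i;
  [exact: trop1 | exact: tropM | exact: tropV].
Qed.

Lemma UD_chi_eps i : UD (gc_eps (chi R) i) x = trop_eps x i.
Proof.
apply: trop_UD; apply: trop_eps_correct (trop_coords) i;
  [exact: trop1 | exact: tropD | exact: tropM | exact: tropV].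
Qed.

Lemma UD_chi_e i a : UD_action (chi R) i a x = trop_e a x i.
Proof.
apply/rowP => j; rewrite mxE; apply: trop_UD; apply: trop_e_correct.
- exact: trop1.
- exact: tropD.
- exact: tropM.
- exact: tropV.
- have aE : row_mx (const_mx a : 'rV_1) x 0 ord0 = a.
    have <- : lshift 6 (ord0 : 'I_1) = ord0 by exact: val_inj.
    by rewrite row_mxEl mxE.
  rewrite -[X in trop _ _ X]aE; exact: trop_coord.
move=> l; have <- : row_mx (const_mx a : 'rV_1) x 0 (lift ord0 l) = x 0 l.
  rewrite -(row_mxEr (const_mx a : 'rV_1) x); congr (row_mx _ _ _ _).
  exact: val_inj.
rewrite mxE; exact: trop_coord.
Qed.

End UDChi.

(** * The linear map to the coordinates of B_oo *)

Definition Omega_coords (x : 'rV[int]_6) : coords :=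
  let y l : rat := (x 0 (inord l))%:~R in
  Coords (y 5) (y 4 / 3 - y 5) (y 3 - 2 / 3 * y 4)
         (2 / 3 * y 2 - y 3) (y 1 - y 2 / 3) (y 0 - y 1).

Definition irow6 (s : seq int) : 'rV[int]_6 := \row_(j < 6) s`_j.

Lemma irow6E s l : (l < 6)%N -> irow6 s 0 (inord l) = s`_l.
Proof. by move=> l6; rewrite mxE inordK. Qed.

Lemma Omega_irow6 a0 a1 a2 a3 a4 a5 :
  Omega_coords (irow6 [:: a0; a1; a2; a3; a4; a5]) =
  Coords a5%:~R (a4%:~R / 3 - a5%:~R) (a3%:~R - 2 / 3 * a4%:~R)
    (2 / 3 * a2%:~R - a3%:~R) (a1%:~R - a2%:~R / 3) (a0%:~R - a1%:~R).
Proof. by rewrite /Omega_coords !irow6E. Qed.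

(** Brings the exponent of E, taken relative to that of p2, into the order in which the set A of
    phi_0 lists its elements. *)
Lemma max6_subr (K : realDomainType) (a1 a2 a3 a4 a5 a6 : K) :
  Num.max (Num.max (Num.max (Num.max (Num.max a1 a2) a3) a4) a5) a6 - a2 =
  Num.max (a4 - a2) (Num.max (a3 - a2) (Num.max (a5 - a2)
    (Num.max (a6 - a2) (Num.max (a1 - a2) 0)))).
Proof.
rewrite !addr_maxl subrr; apply/le_anti.
by rewrite !(ge_max, le_max) !lexx !orbT.
Qed.

(** * Kashiwara operators of B_oo in the coordinates x, beginning with index 0 *)

Section Moves.
Variable x : 'rV[int]_6.

Let x0 := x 0 (inord 0).
Let x1 := x 0 (inord 1).
Let x2 := x 0 (inord 2).
Let x3 := x 0 (inord 3).
Let x4 := x 0 (inord 4).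
Let x5 := x 0 (inord 5).
Let p := trop_p x.
Let b := Omega_coords x.

(* Ties between leading terms go to the first of 2, 4, 3, 5, 6, 1 for (F_l) and
   to the last one for (E_l).  Since p1 + p2 = p4 + p6, comparing p4 with p2 is
   comparing p1 with p6, and comparing p6 with p2 is comparing p1 with p4. *)
Definition dominates (gt le : rel int) (l : nat) : bool :=
  match l with
  | 1%N => [&& le (p 6) (p 2), le (p 5) (p 2), le (p 3) (p 2) & le (p 4) (p 2)]
  | 2%N => [&& le (p 6) (p 2), le (p 5) (p 4), le (p 3) (p 4) & gt (p 4) (p 2)]
  | 3%N => [&& le (p 1) (p 3), le (p 6) (p 3), le (p 5) (p 3), gt (p 3) (p 4)
             & gt (p 3) (p 2)]
  | 4%N => [&& gt (p 5) (p 2), gt (p 5) (p 4), gt (p 5) (p 3), le (p 6) (p 5)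
             & le (p 1) (p 5)]
  | 5%N => [&& gt (p 6) (p 2), gt (p 6) (p 3), gt (p 6) (p 5) & le (p 4) (p 2)]
  | 6%N => [&& gt (p 6) (p 2), gt (p 1) (p 3), gt (p 1) (p 5) & gt (p 4) (p 2)]
  | _ => false
  end.

Let z4E : (cb3 b - b3 b) / 2 = (p 5 - p 3)%:~R / 3.
Proof.
rewrite /b /p /trop_p /=.
by rewrite !(rmorphB, rmorphD, rmorphMn) /=; field.
Qed.

(** Each linear form in the conditions is a difference of two exponents, except z4, which is a third
    of [p 5 - p 3]; hence the sign tests must ignore division by 3. *)
Lemma cond_Omega (gt0 le0 : pred rat) (gt le : rel int) l :
  (forall m n : int, gt0 (m - n)%:~R = gt m n) ->
  (forall m n : int, le0 (m - n)%:~R = le m n) ->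
  (forall y : rat, gt0 (y / 3) = gt0 y) ->
  (forall y : rat, le0 (y / 3) = le0 y) ->
  cond b gt0 le0 l = dominates gt le l.
Proof.
move=> gtE leE gt3 le3.
case: l => [|[|[|[|[|[|[|//]]]]]]] //; rewrite /cond /dominates z4E ?gt3 ?le3;
rewrite -?gtE -?leE;
repeat congr (_ && _); first [congr (gt0 _) | congr (le0 _)];
rewrite /b /p /trop_p /=; rewrite !(rmorphB, rmorphD, rmorphMn) /=; by field.
Qed.

Lemma condF_Omega l :
  condF b l = dominates (fun m n => n < m) (fun m n => m <= n) l.
Proof.
apply: cond_Omega => [m n|m n|y|y].
- by rewrite ltr0z subr_gt0.
- by rewrite lerz0 subr_le0.
- by rewrite pmulr_lgt0.
- by rewrite pmulr_lle0.
Qed.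

Lemma condE_Omega l :
  condE b l = dominates (fun m n => n <= m) (fun m n => m < n) l.
Proof.
apply: cond_Omega => [m n|m n|y|y].
- by rewrite ler0z subr_ge0.
- by rewrite ltrz0 subr_lt0.
- by rewrite pmulr_lge0.
- by rewrite pmulr_llt0.
Qed.

Let p_rel : p 1 + p 2 = p 4 + p 6.
Proof. rewrite /p /trop_p; lia. Qed.

(** Linearity of [Omega_coords]: an operator is determined by the changes it makes to the
    x-coordinates. *)
Lemma Omega_shift v0 v1 v2 v3 v4 v5 :
  Omega_coords
    (irow6 [:: v0 + x0; v1 + x1; v2 + x2; v3 + x3; v4 + x4; v5 + x5]) =
  shift b (Coords v5%:~R (v4%:~R / 3 - v5%:~R) (v3%:~R - 2 / 3 * v4%:~R)
    (2 / 3 * v2%:~R - v3%:~R) (v1%:~R - v2%:~R / 3) (v0%:~R - v1%:~R)).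
Proof.
rewrite Omega_irow6 /shift /b /Omega_coords.
cbn [b1 b2 b3 cb1 cb2 cb3]; rewrite -/x0 -/x1 -/x2 -/x3 -/x4 -/x5 !intrD.
by congr Coords; field.
Qed.

(** With the tropical values and the changes as parameters, treating a cone amounts to supplying
    them and checking eleven integer equations. *)
Lemma Omega_trop_e0 c (i : 'I_3) E D F H G d0 d1 d2 d3 d4 d5 :
  val i = 0%N ->
  trop_E x = E -> trop_D c x = D -> trop_F c x = F -> trop_H c x = H ->
  trop_G c x = G ->
  D - (c + E) = d0 -> F - (c + E) = d1 -> G - (c *+ 3 + E *+ 3) = d2 ->
  D + H - (c *+ 2 + E + F) = d3 -> D *+ 3 - (c *+ 3 + G) = d4 ->
  D - (c + H) = d5 ->
  Omega_coords (trop_e c x i) =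
  shift b (Coords d5%:~R (d4%:~R / 3 - d5%:~R) (d3%:~R - 2 / 3 * d4%:~R)
    (2 / 3 * d2%:~R - d3%:~R) (d1%:~R - d2%:~R / 3) (d0%:~R - d1%:~R)).
Proof.
move=> i0 <- <- <- <- <- <- <- <- <- <- <-.
by rewrite -Omega_shift /trop_e i0.
Qed.

(** The six exponents become free integers tied only by [p_rel]; the coordinates x disappear before
    [lia] runs. *)
Local Ltac p_lia :=
  rewrite ?/dominates /trop_E /trop_D /trop_F /trop_H /trop_G /trop_L -/p;
  repeat match goal with
    | h : is_true (dominates _ _ _) |- _ => move: h
    end;
  repeat match goal with h : _ - _ = _ |- _ => move: h end;
  repeat match goal with h : (_ == _) = false |- _ => move: h end;
  rewrite ?/dominates; move: p_rel; clear;
  generalize (p 1) (p 2) (p 3) (p 4) (p 5) (p 6) => p1 p2 p3 p4 p5 p6;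
  lia.

(* Arguments: the linear values of E, D, F, H, G on the cone, then the changes of
   x0, ..., x5. *)
Local Tactic Notation "dominant" hyp(i0) uconstr(e) uconstr(d) uconstr(f)
  uconstr(h) uconstr(g) uconstr(d0) uconstr(d1) uconstr(d2) uconstr(d3)
  uconstr(d4) uconstr(d5) :=
  refine (etrans (@Omega_trop_e0 _ _ e d f h g d0 d1 d2 d3 d4 d5 i0
    _ _ _ _ _ _ _ _ _ _ _) _);
  [p_lia..
  |congr (shift _ _); congr Coords; apply/eqP; vm_compute; reflexivity].

Let third_eq (m n : int) (q : rat) :
  q = n%:~R / 3 -> (m%:~R / 3 == q) = (m == n).
Proof.
by move=> ->; rewrite -subr_eq0 -mulrBl mulf_eq0 orbF subr_eq0 eqr_int.
Qed.

Lemma move_e0_Omega (i : 'I_3) :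
  val i = 0%N -> Omega_coords (trop_e 1 x i) = shift b (move_e0 b).
Proof.
move=> i0; rewrite /move_e0 !condE_Omega z4E.
rewrite (@third_eq _ (-1)) ?(@third_eq _ (-2)); [|by rewrite rmorphN /=; lra..].
case: ifP => [h|h1].
  dominant i0 (p 2) (p 2) (p 2) (p 2) (p 2 *+ 3)
    (-1) (-1) (-3) (-2) (-3) (-1).
case: ifP => [h|h2].
  dominant i0 (p 4) (1 + p 4) (p 4) (p 4) (p 4 *+ 3)
    0 (-1) (-3) (-1) 0 0.
case: ifP => [h|h3].
  (* Here [p 5 < p 3] and G has exponent [p 3 *+ 2 + Num.max (p 3) (3 + p 5)], from its last
     summand. The factor c^3 lets p5 overtake p3 exactly when they differ by 1 or 2. *)
  case: ifP => [/eqP w|w1].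
    dominant i0 (p 3) (1 + p 3) (1 + p 3) (p 3) (2 + p 3 *+ 3)
      0 0 (-1) (-2) (-2) 0.
  case: ifP => [/eqP w|w2].
    dominant i0 (p 3) (1 + p 3) (1 + p 3) (p 3) (1 + p 3 *+ 3)
      0 0 (-2) (-2) (-1) 0.
  dominant i0 (p 3) (1 + p 3) (1 + p 3) (p 3) (p 3 *+ 3)
      0 0 (-3) (-2) 0 0.
case: ifP => [h|h4].
  dominant i0 (p 5) (1 + p 5) (1 + p 5) (p 5) (3 + p 5 *+ 3)
    0 0 0 (-2) (-3) 0.
case: ifP => [h|h5].
  dominant i0 (p 6) (1 + p 6) (1 + p 6) (1 + p 6) (3 + p 6 *+ 3)
    0 0 0 (-1) (-3) (-1).
case: ifP => [h|h6].
  dominant i0 (p 1) (2 + p 1) (1 + p 1) (1 + p 1) (3 + p 1 *+ 3)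
    1 0 0 0 0 0.
(* The six cones cover everything, so the default [no_move] is never reached. *)
exfalso; move: h1 h2 h3 h4 h5 h6; rewrite /dominates; p_lia.
Qed.

Lemma move_f0_Omega (i : 'I_3) :
  val i = 0%N -> Omega_coords (trop_e (-1) x i) = shift b (move_f0 b).
Proof.
move=> i0; rewrite /move_f0 !condF_Omega z4E.
rewrite (@third_eq _ 1) ?(@third_eq _ 2) //.
case: ifP => [h|h1].
  dominant i0 (p 2) (p 2) (p 2) (p 2) (p 2 *+ 3)
    1 1 3 2 3 1.
case: ifP => [h|h2].
  dominant i0 (p 4) (p 4 - 1) (p 4) (p 4) (p 4 *+ 3)
    0 1 3 1 0 0.
case: ifP => [h|h3].
  dominant i0 (p 3) (p 3 - 1) (p 3 - 1) (p 3) (p 3 *+ 3)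
    0 0 3 2 0 0.
case: ifP => [h|h4].
  (* Now [p 3 < p 5] and G has exponent [p 5 *+ 2 + Num.max (p 3) (p 5 - 3)], where p3 wins exactly
     for a gap of 1 or 2. *)
  case: ifP => [/eqP w|w1].
    dominant i0 (p 5) (p 5 - 1) (p 5 - 1) (p 5) (p 5 *+ 3 - 1)
      0 0 2 2 1 0.
  case: ifP => [/eqP w|w2].
    dominant i0 (p 5) (p 5 - 1) (p 5 - 1) (p 5) (p 5 *+ 3 - 2)
      0 0 1 2 2 0.
  dominant i0 (p 5) (p 5 - 1) (p 5 - 1) (p 5) (p 5 *+ 3 - 3)
      0 0 0 2 3 0.
case: ifP => [h|h5].
  dominant i0 (p 6) (p 6 - 1) (p 6 - 1) (p 6 - 1) (p 6 *+ 3 - 3)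
    0 0 0 1 3 1.
case: ifP => [h|h6].
  dominant i0 (p 1) (p 1 - 2) (p 1 - 1) (p 1 - 1) (p 1 *+ 3 - 3)
    (-1) 0 0 0 0 0.
exfalso; move: h1 h2 h3 h4 h5 h6; rewrite /dominates; p_lia.
Qed.

(** * Operators of index 1 and 2 *)

Let m := x1 - x2 + x3.
Let n := x4 - x3 - x5.

Let mE : cb2 b - cb3 b = m%:~R.
Proof.
by rewrite /b /m /=; rewrite !(rmorphB, rmorphD) /= -/x1 -/x2 -/x3; field.
Qed.

Let nE : b2 b - b3 b = n%:~R.
Proof.
by rewrite /b /n /=; rewrite !(rmorphB, rmorphD) /= -/x3 -/x4 -/x5; field.
Qed.

Let w'E : cb3 b - b3 b = 2 / 3 * (p 5 - p 3)%:~R.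
Proof. by rewrite -[LHS](@divfK _ 2) // z4E; field. Qed.

Let wE : b3 b - cb3 b = 2 / 3 * (p 3 - p 5)%:~R.
Proof. by rewrite -opprB w'E -mulrN -mulrNz opprB. Qed.

Let max0z (q : int) : Num.max q%:~R 0 = (Num.max q 0)%:~R :> rat.
Proof. by rewrite !maxEle -(ler_int rat); case: ifP. Qed.

(** [m] and [n] are the exponents of A1 and A3 relative to A2, so dividing all terms by A2 leaves
    maxima in these two alone. *)
Lemma Omega_trop_e1 c (i : 'I_3) d1 d3 d5 : val i = 1%N ->
  Num.max (Num.max (c + m) 0) n - Num.max (Num.max m 0) n = d1 ->
  Num.max (Num.max (c + m) c) n - Num.max (Num.max (c + m) 0) n = d3 ->
  c + Num.max (Num.max m 0) n - Num.max (Num.max (c + m) c) n = d5 ->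
  Omega_coords (trop_e c x i) = shift b
    (Coords d5%:~R (- d5%:~R) d3%:~R (- d3%:~R) d1%:~R (- d1%:~R)).
Proof.
move=> i1 h1 h3 h5.
rewrite (_ : trop_e c x i =
  irow6 [:: 0 + x0; d1 + x1; 0 + x2; d3 + x3; 0 + x4; d5 + x5]).
  by rewrite Omega_shift !(mul0r, mulr0, subr0, sub0r).
rewrite /trop_e i1 -/x0 -/x1 -/x2 -/x3 -/x4 -/x5 !add0r.
move: h1 h3 h5; rewrite /m /n.
generalize x0 x1 x2 x3 x4 x5 => y0 y1 y2 y3 y4 y5; clear => h1 h3 h5.
apply/rowP => j; rewrite !mxE; congr (nth _ _ _).
by congr [:: _; _; _; _; _; _]; lia.
Qed.

(** B1 / B2 equals p5 / p3, so [p 5 - p 3] governs index 2 as well. *)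
Lemma Omega_trop_e2 c (i : 'I_3) d2 d4 : val i = 2%N ->
  Num.max (c + (p 5 - p 3)) 0 - Num.max (p 5 - p 3) 0 = d2 ->
  c + Num.max (p 5 - p 3) 0 - Num.max (c + (p 5 - p 3)) 0 = d4 ->
  Omega_coords (trop_e c x i) = shift b
    (Coords 0 (d4%:~R / 3) (- (2 / 3 * d4%:~R)) (2 / 3 * d2%:~R)
      (- (d2%:~R / 3)) 0).
Proof.
move=> i2 h2 h4.
rewrite (_ : trop_e c x i =
  irow6 [:: 0 + x0; 0 + x1; d2 + x2; 0 + x3; d4 + x4; 0 + x5]).
  by rewrite Omega_shift !(mul0r, mulr0, subr0, sub0r).
rewrite /trop_e i2 -/x0 -/x1 -/x2 -/x3 -/x4 -/x5 !add0r.
move: h2 h4; rewrite /p /trop_p -/x0 -/x1 -/x2 -/x3 -/x4.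
generalize x0 x1 x2 x3 x4 x5 => y0 y1 y2 y3 y4 y5; clear => h2 h4.
apply/rowP => j; rewrite !mxE; congr (nth _ _ _).
by congr [:: _; _; _; _; _; _]; lia.
Qed.

(** The branches say which of A1, A2, A3 is leading. Ties go to the first for c = 1 and to the last
    for c = -1, since raising a term by 1 raises a maximum it ties for, while lowering it does not
    lower that maximum. *)
Lemma move_e1_Omega (i : 'I_3) : val i = 1%N ->
  Omega_coords (trop_e 1 x i) = shift b (move_e1 b).
Proof.
move=> i1; rewrite /move_e1 -(opprB (b2 b)) mE nE !max0z -rmorphN /=.
rewrite !ler_int !ltr_int ltrz0 ler0z.
case: ifP => [h|h1].
  by rewrite (@Omega_trop_e1 _ _ 1 0 0) //; move: h; clear; lia.
case: ifP => [h|h2].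
  by rewrite (@Omega_trop_e1 _ _ 0 1 0) //; move: h; clear; lia.
case: ifP => [h|h3].
  by rewrite (@Omega_trop_e1 _ _ 0 0 1) //; move: h; clear; lia.
by exfalso; move: h1 h2 h3; clear; lia.
Qed.

Lemma move_f1_Omega (i : 'I_3) : val i = 1%N ->
  Omega_coords (trop_e (-1) x i) = shift b (move_f1 b).
Proof.
move=> i1; rewrite /move_f1 -(opprB (b2 b)) mE nE !max0z -rmorphN /=.
rewrite !ler_int !ltr_int lerz0 ltr0z.
case: ifP => [h|h1].
  by rewrite (@Omega_trop_e1 _ _ 0 0 (-1)) //; move: h; clear; lia.
case: ifP => [h|h2].
  by rewrite (@Omega_trop_e1 _ _ 0 (-1) 0) //; move: h; clear; lia.
case: ifP => [h|h3].
  by rewrite (@Omega_trop_e1 _ _ (-1) 0 0) //; move: h; clear; lia.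
by exfalso; move: h1 h2 h3; clear; lia.
Qed.

Let le_cb3_b3 : (cb3 b <= b3 b) = (p 5 - p 3 <= 0).
Proof. by rewrite -subr_ge0 wE -oppr_ge0 opprB -(ler0z rat); lra. Qed.

Let le_b3_cb3 : (b3 b <= cb3 b) = (0 <= p 5 - p 3).
Proof. by rewrite -subr_le0 wE -oppr_le0 opprB -(lerz0 rat); lra. Qed.

Lemma move_e2_Omega (i : 'I_3) : val i = 2%N ->
  Omega_coords (trop_e 1 x i) = shift b (move_e2 b).
Proof.
move=> i2; rewrite /move_e2 le_b3_cb3; case: ifP => h.
  rewrite (@Omega_trop_e2 _ _ 1 0) //; move: h; clear; lia.
rewrite (@Omega_trop_e2 _ _ 0 1) //; move: h; clear; lia.
Qed.

Lemma move_f2_Omega (i : 'I_3) : val i = 2%N ->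
  Omega_coords (trop_e (-1) x i) = shift b (move_f2 b).
Proof.
move=> i2; rewrite /move_f2 le_cb3_b3; case: ifP => h.
  rewrite (@Omega_trop_e2 _ _ 0 (-1)) //; move: h; clear; lia.
rewrite (@Omega_trop_e2 _ _ (-1) 0) //; move: h; clear; lia.
Qed.

Lemma move_e_Omega i : Omega_coords (trop_e 1 x i) = shift b (move_e b i).
Proof.
case: i => -[|[|[|//]]] ?.
- exact: move_e0_Omega.
- exact: move_e1_Omega.
- exact: move_e2_Omega.
Qed.

Lemma move_f_Omega i : Omega_coords (trop_e (-1) x i) = shift b (move_f b i).
Proof.
case: i => -[|[|[|//]]] ?.
- exact: move_f0_Omega.
- exact: move_f1_Omega.
- exact: move_f2_Omega.
Qed.

(** * The functions eps and phi *)

Let maxz (q r : int) : (Num.max q r)%:~R = Num.max q%:~R r%:~R :> rat.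
Proof. by rewrite !maxEle ler_int; case: ifP. Qed.

(** The product of eps_0 and gamma_0 is E / (x0 p2); s(b) becomes x0, and max A the exponent of E /
    p2. *)
Lemma Bphi0_Omega (i : 'I_3) : val i = 0%N ->
  Bphi_rat b i = (trop_E x - p 2 - x0)%:~R.
Proof.
move=> i0; rewrite /Bphi_rat i0 /=.
rewrite (_ : trop_E x - p 2 = Num.max (p 4 - p 2)
  (Num.max (p 3 - p 2) (Num.max (p 5 - p 2) (Num.max (p 6 - p 2)
  (Num.max (p 1 - p 2) 0))))); last first.
  exact: max6_subr.
rewrite addrC rmorphD rmorphN /= !maxz.
congr (_ + _); last by rewrite /b /x0 /=; field.
congr (Num.max _ (Num.max _ (Num.max _ (Num.max _ (Num.max _ _))))) => //;
by rewrite /b /p /trop_p /= !(rmorphB, rmorphD, rmorphMn) /=; field.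
Qed.

Lemma Bphi_Omega i : Bphi_rat b i = (trop_eps x i + trop_gamma x i)%:~R.
Proof.
case: i => -[|[|[|//]]] ?;
  rewrite /trop_eps /trop_gamma /= -/x0 -/x1 -/x2 -/x3 -/x4 -/x5.
- rewrite Bphi0_Omega //; congr _%:~R.
  by rewrite /p /trop_p -/x0 -/x1 -/x2 -/x3 -/x4 -/x5; ring.
- rewrite /Bphi_rat /= -(opprB (b2 b)) mE nE max0z -rmorphN -rmorphD max0z.
  rewrite -rmorphD /=.
   congr _%:~R; rewrite /m /n -/x5.
  by generalize x0 x1 x2 x3 x4 x5 => y0 y1 y2 y3 y4 y5; clear; lia.
(* Writing 0 as [2 / 3 * 0] lets the factor leave the maximum and cancel 3/2. *)
- rewrite /Bphi_rat /= w'E -[X in Num.max _ X](mulr0 (2 / 3)).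
  rewrite -maxr_pMr // max0z mulrA (_ : 3 / 2 * (2 / 3) = 1 :> rat) // mul1r.
  rewrite (_ : 3 * b2 b = (x4 - 3 * x5)%:~R); last first.
    by rewrite /b /= -/x4 -/x5 rmorphB rmorphM /=; field.
  rewrite -rmorphD; congr _%:~R; rewrite /p /trop_p -/x0 -/x1 -/x2 -/x3 -/x4.
  by generalize x0 x1 x2 x3 x4 x5 => y0 y1 y2 y3 y4 y5; clear; lia.
Qed.

Lemma Beps_Omega i : Beps_rat b i = (trop_eps x i)%:~R.
Proof.
case: i => -[|[|[|//]]] lt_i;
  rewrite /trop_eps /= -/x0 -/x1 -/x2 -/x3 -/x4 -/x5.
- have := Bphi0_Omega (erefl (val (Ordinal lt_i))).
  rewrite /Bphi_rat /Beps_rat /= => ->.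
  (* eps_0 = E / (x0 p1) is the expression for phi_0 with p1 in place of p2. *)
  rewrite (_ : 2 * _ + _ + _ + _ = (p 1 - p 2)%:~R); last first.
    by rewrite /b /p /trop_p /= !(rmorphB, rmorphD, rmorphMn) /=; field.
  rewrite -rmorphB; congr _%:~R.
  by rewrite /p /trop_p -/x0 -/x1 -/x2 -/x3 -/x4 -/x5; ring.
- rewrite /Beps_rat /= -(opprB (cb2 b)) mE nE max0z -[- m%:~R]mulrNz.
  rewrite -[(- m)%:~R + _]intrD max0z.
  rewrite -/x0 -/x1 -intrB -intrD.
  congr _%:~R; rewrite /m /n.
  by generalize x0 x1 x2 x3 x4 x5 => y0 y1 y2 y3 y4 y5; clear; lia.
- rewrite /Beps_rat /= wE -[X in Num.max _ X](mulr0 (2 / 3)).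
  rewrite -maxr_pMr // max0z mulrA (_ : 3 / 2 * (2 / 3) = 1 :> rat) // mul1r.
  rewrite (_ : 3 * cb2 b = (3 * x1 - x2)%:~R); last first.
    by rewrite /b /= -/x1 -/x2 rmorphB rmorphM /=; field.
  rewrite -rmorphD; congr _%:~R; rewrite /p /trop_p -/x0 -/x1 -/x2 -/x3 -/x4.
  by generalize x0 x1 x2 x3 x4 x5 => y0 y1 y2 y3 y4 y5; clear; lia.
Qed.
End Moves.

(** * Bijectivity onto B_oo *)

Lemma in_Binf_Omega x : in_Binf (Omega_coords x).
Proof.
have int_eq (q : rat) (k : int) : q = k%:~R -> q \is a Num.int.
  by move=> ->; exact: intr_int.
rewrite /in_Binf /Omega_coords; cbn [b1 b2 b3 cb3 cb2 cb1].
move: (x 0 (inord 0)) (x 0 (inord 1)) (x 0 (inord 2)) (x 0 (inord 3))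
  (x 0 (inord 4)) (x 0 (inord 5)) => x0 x1 x2 x3 x4 x5.
apply/and5P; split; first (apply/and5P; split; last (apply/andP; split)).
- by apply: (int_eq _ (3 * x5)); rewrite intrM.
- by apply: (int_eq _ (x4 - 3 * x5)); rewrite intrB intrM; field.
- by apply: (int_eq _ (3 * x3 - 2 * x4)); rewrite intrB !intrM; field.
- by apply: (int_eq _ (2 * x2 - 3 * x3)); rewrite intrB !intrM; field.
- by apply: (int_eq _ (3 * x1 - x2)); rewrite intrB !intrM; field.
- by apply: (int_eq _ (3 * x0 - 3 * x1)); rewrite intrB !intrM; field.
- by apply: (int_eq _ (3 * x3 - x2 - x4)); rewrite !intrB !intrM; field.
- exact: (int_eq _ x5).
- by apply: (int_eq _ (x0 - x1)); rewrite intrB.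
apply/andP; split.
- by apply: (int_eq _ (x4 - x3 - x5)); rewrite !intrB; field.
- by apply: (int_eq _ (x2 - x3 - x1)); rewrite !intrB; field.
Qed.

Definition Omega (x : 'rV[int]_6) : Binf_set :=
  exist _ (Omega_coords x) (in_Binf_Omega x).

(** The triangular system is solved from x5 = b1 up to x0 = s(b). The floors only change the type,
    as their arguments are integers on B_oo. *)
Definition Omega_inv (b : Binf_set) : 'rV[int]_6 :=
  let: Coords b1 b2 b3 cb3 cb2 cb1 := val b in
  irow6 [seq Num.floor y | y <-
    [:: b1 + b2 + (b3 + cb3) / 2 + cb2 + cb1; b1 + b2 + (b3 + cb3) / 2 + cb2;
        3 * (b1 + b2) + 3 / 2 * (b3 + cb3); 2 * (b1 + b2) + b3;
        3 * (b1 + b2); b1]].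

Lemma OmegaK : cancel Omega Omega_inv.
Proof.
move=> x; apply/rowP => j; rewrite /Omega_inv /Omega /Omega_coords [val _]/=.
rewrite mxE -[j in RHS]inord_val.
case: j => -[|[|[|[|[|[|//]]]]]] ?; rewrite [nth _ _ _]/= [val _]/=;
by rewrite -[RHS](@intrKfloor rat); congr Num.floor; field.
Qed.

Lemma Omega_invK : cancel Omega_inv Omega.
Proof.
case=> -[b1 b2 b3 cb3 cb2 cb1] hb; apply: val_inj; rewrite /Omega_inv /=.
move: (hb); rewrite /in_Binf.
cbn [Defs.b1 Defs.b2 Defs.b3 Defs.cb3 Defs.cb2 Defs.cb1].
move=> /and5P[/and5P[_ h2 _ h4 _] h7 h1 h9 /andP[h10 h11]].
have int3 : (3 : rat) \is a Num.int by [].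
have y4 : 3 * (b1 + b2) \is a Num.int.
  by rewrite mulrDr rpredD // rpredM.
have y3 : 2 * (b1 + b2) + b3 \is a Num.int.
  rewrite (_ : _ + b3 = 3 * (b1 + b2) - b1 - (b2 - b3)); last by field.
  by rewrite rpredB // rpredB.
have y2 : 3 * (b1 + b2) + 3 / 2 * (b3 + cb3) \is a Num.int.
  (* The half is integral by the congruence of 3 b3 and 3 cb3 modulo 2. *)
  rewrite (_ : 3 / 2 * _ = (3 * b3 - 3 * cb3) / 2 + 3 * cb3); last by field.
  by rewrite !rpredD.
have y1 : b1 + b2 + (b3 + cb3) / 2 + cb2 \is a Num.int.
  rewrite (_ : _ + cb2 = b1 + (b2 - b3) + (3 * b3 - 3 * cb3) / 2 + 3 * cb3
    - (cb3 - cb2)); last by field.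
  by rewrite rpredB // rpredD // rpredD // rpredD.
have y0 : b1 + b2 + (b3 + cb3) / 2 + cb2 + cb1 \is a Num.int by rewrite rpredD.
rewrite Omega_irow6 !floorK //.
by congr Coords; field.
Qed.

(** * The crystal isomorphism *)

Lemma Omega_move_e (R : realType) i (x : UD_crystal (chi R)) :
  Omega (ke i x) = ke i (Omega x : Binf).
Proof. by apply: val_inj; rewrite /= UD_chi_e move_e_Omega. Qed.

Lemma Omega_move_f (R : realType) i (x : UD_crystal (chi R)) :
  Omega (kf i x) = kf i (Omega x : Binf).
Proof. by apply: val_inj; rewrite /= UD_chi_e move_f_Omega. Qed.

Lemma Omega_eps (R : realType) i (x : UD_crystal (chi R)) :
  eps i (Omega x : Binf) = eps i x.
Proof. by rewrite /= UD_chi_eps /Binf_eps Beps_Omega intrKfloor. Qed.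

Lemma Omega_phi (R : realType) i (x : UD_crystal (chi R)) :
  phi i (Omega x : Binf) = phi i x.
Proof.
by rewrite /= UD_chi_eps UD_chi_gamma /Binf_phi Bphi_Omega intrKfloor.
Qed.

Theorem theorem6p1 (R : realType) : isomorphic (UD_crystal (chi R)) Binf.
Proof.
exists Omega; split.
  by exists Omega_inv; [exact: OmegaK | exact: Omega_invK].
move=> x; split=> [|i]; last first.
  by split; [exact: Omega_move_e | exact: Omega_move_f | exact: Omega_eps
    | exact: Omega_phi].
(* On both sides the weight is phi - eps, so it is preserved once these are. *)
apply/rowP => i; have := Omega_eps i x; have := Omega_phi i x.
by rewrite /= !mxE => -> ->; rewrite addrC addKr.
Qed.
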